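(* Let $(E,\mathcal{P})$ be an $L^0$-pre-barreled random locally convex module over $\mathbb{R}$ with base $(\Omega,\mathcal{F},P)$ such that $E$ has the countable concatenation property. Then, for every proper $\mathcal{T}_c$-lower semicontinuous $L^0$-convex function $f:E\to\bar L^0(\mathcal{F})$, $\partial f(x)\neq\emptyset$ for all $x\in\mathrm{Int}(\mathrm{dom}(f))$, where $\mathrm{Int}(\mathrm{dom}(f))$ is the $\mathcal{T}_c$-interior of $\mathrm{dom}(f)$.
   Context: Notation. $(\Omega,\mathcal{F},P)$ is a probability space; $L^0(\mathcal{F})$ is the algebra of a.s.-equivalence classes of real-valued $\mathcal{F}$-measurable random variables; $\bar L^0(\mathcal{F})$ the set of classes of extended real-valued ones, ordered a.s., $\bigvee$ denotes supremum; $L^0_+(\mathcal{F})=\{\xi\in L^0(\mathcal{F}):\xi\ge0\}$, $L^0_{++}(\mathcal{F})=\{\xi\in L^0(\mathcal{F}):\xi>0\text{ a.s.}\}$; $\tilde I_A$ is the class of the indicator of $A\in\mathcal{F}$. ''On $\Omega$'' means a.s. An $L^0$-seminorm on an $L^0(\mathcal{F})$-module $E$ is a map $\|\cdot\|:E\to L^0_+(\mathcal{F})$ with $\|\xi x\|=|\xi|\|x\|$ for $\xi\in L^0(\mathcal{F})$ and $\|x+y\|\le\|x\|+\|y\|$. A random locally convex module $(E,\mathcal{P})$ over $\mathbb{R}$ with base $(\Omega,\mathcal{F},P)$ is an $L^0(\mathcal{F})$-module $E$ with a family $\mathcal{P}$ of $L^0$-seminorms such that $\bigvee\{\|x\|:\|\cdot\|\in\mathcal{P}\}=0$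 iff $x=\theta$ (the null element). $\mathcal{T}_c$ is the translation-invariant topology with local base at $\theta$ given by $\{x:\bigvee_{\|\cdot\|\in\mathcal{Q}}\|x\|\le\varepsilon\}$, $\mathcal{Q}\subset\mathcal{P}$ finite, $\varepsilon\in L^0_{++}(\mathcal{F})$; $L^0(\mathcal{F})$ carries $\mathcal{T}_c$ induced by $|\cdot|$. $E^\ast_c$ is the set of continuous module homomorphisms from $(E,\mathcal{T}_c)$ to $(L^0(\mathcal{F}),\mathcal{T}_c)$. A subset $G$ of $E$ (possibly $G=E$) has the countable concatenation property if for every sequence $\{x_n\}$ in $G$ and every countable partition $\{A_n\}$ of $\Omega$ into members of $\mathcal{F}$ there is $x\in G$ with $\tilde I_{A_n}x=\tilde I_{A_n}x_n$ for all $n$. An $L^0$-barrel is a $\mathcal{T}_c$-closed set $B\subset E$ that is $L^0$-balanced ($\eta B\subset B$ for $\eta\in L^0(\mathcal{F})$, $|\eta|\le1$), $L^0$-convex ($\xi x+(1-\xi)y\in B$ for $x,y\in B$, $\xi\in L^0_+(\mathcal{F})$, $0\le\xi\le1$) and $L^0$-absorbent (for each $x\in E$ there is $\xi\in L^0_{++}(\mathcal{F})$ with $\eta x\in B$ for all $\eta\in L^0(\mathcal{F})$, $|\eta|\le\xi$). $(E,\mathcal{P})$ is $L^0$-pre-barreled if every $L^0$-barrel with the countable concatenation property is a $\mathcal{T}_c$-neighborhood of $\theta$. For $f:E\to\bar L^0(\mathcal{F})$, $\mathrm{dom}(f)=\{x\in E:f(x)<+\infty\text{ on }\Omega\}$.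 $f$ is proper if $\mathrm{dom}(f)\ne\emptyset$ and $f(x)>-\infty$ on $\Omega$ for all $x\in E$. $f$ is $L^0$-convex if $f(\xi x+(1-\xi)y)\le\xi f(x)+(1-\xi)f(y)$ for all $x,y\in E$ and $\xi\in L^0_+(\mathcal{F})$, $0\le\xi\le1$, with $0\cdot(\pm\infty)=0$ and $+\infty\pm(\pm\infty)=+\infty$. $f$ is $\mathcal{T}_c$-lower semicontinuous if $\{x\in E:f(x)\le r\}$ is $\mathcal{T}_c$-closed for every $r\in L^0(\mathcal{F})$. For $x\in\mathrm{dom}(f)$, $\partial f(x)=\{u\in E^\ast_c:u(y-x)\le f(y)-f(x)\text{ for all }y\in E\}$. *)

(* Defs.v *)
From HB Require Import structures.
From mathcomp Require Import all_boot all_order all_algebra generic_quotient.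
From mathcomp Require Import all_classical all_reals all_analysis.
From mathcomp Require Import measurable_realfun.
Set Implicit Arguments.
Unset Strict Implicit.
Unset Printing Implicit Defensive.
Import Order.TTheory GRing.Theory Num.Theory.
Import numFieldNormedType.Exports.

Local Open Scope classical_set_scope.
Local Open Scope ring_scope.
Local Open Scope quotient_scope.

Section aeEqMfun_extra.
Context d1 d2 (R : realType) (T1 : measurableType d1) (T2 : measurableType d2).
Variable mu : {measure set T1 -> \bar R}.

Lemma aeEqMfun_piE (f : {mfun T1 >-> T2}) :
  \forall w \ae mu, (\pi_({mfun_ mu, T1 >-> T2}) f : {mfun_ mu, T1 >-> T2}) w
                    = f w.
Proof.
have /eqmodP/asboolP : (repr (\pi_({mfun_ mu, T1 >-> T2}) f) = f
   %[mod {mfun_ mu, T1 >-> T2}]) by rewrite reprK.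
by apply: filterS => w /(_ I).
Qed.

Lemma aeEqMfun_eqP (x y : {mfun_ mu, T1 >-> T2}) :
  (\forall w \ae mu, x w = y w) <-> x = y.
Proof.
split=> [xy|->]; last exact: aeW.
rewrite -[x]reprK -[y]reprK; apply/eqmodP/asboolP.
by apply: filterS xy => w.
Qed.

End aeEqMfun_extra.

Section L0_def.
Context d (T : measurableType d) (R : realType) (P : probability T R).

Definition L0 : Type := {mfun_ P, T >-> R}.
HB.instance Definition _ := Choice.on L0.
HB.instance Definition _ := EqQuotient.on L0.
(* Evaluation goes through a chosen representative, hence is only meaningful
   almost surely. *)
Definition L0_fun (x : L0) : T -> R := aqEqMfun_to_fun x.

Definition eL0 : Type := {mfun_ P, T >-> \bar R}.
HB.instance Definition _ := Choice.on eL0.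
HB.instance Definition _ := EqQuotient.on eL0.
Definition eL0_fun (x : eL0) : T -> \bar R := aqEqMfun_to_fun x.

End L0_def.
Coercion L0_fun : L0 >-> Funclass.
Coercion eL0_fun : eL0 >-> Funclass.

Section L0_theory.
Context d (T : measurableType d) (R : realType) (P : probability T R).
Implicit Types (x y z : L0 P) (f g : {mfun T >-> R}).

Definition L0_class f : L0 P := \pi_(L0 P) f.

Lemma L0_classE f : \forall w \ae P, L0_class f w = f w.
Proof. exact: aeEqMfun_piE. Qed.

Lemma L0_eqP x y : (\forall w \ae P, x w = y w) <-> x = y.
Proof. exact: aeEqMfun_eqP. Qed.

Definition L0_zero := L0_class 0.
Definition L0_one := L0_class 1.
Definition L0_opp x := L0_class (- repr x).
Definition L0_add x y := L0_class (repr x + repr y).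
Definition L0_mul x y := L0_class (repr x * repr y).

Let zeroE : \forall w \ae P, L0_zero w = 0. Proof. exact: L0_classE. Qed.
Let oneE : \forall w \ae P, L0_one w = 1. Proof. exact: L0_classE. Qed.
Let oppE x : \forall w \ae P, L0_opp x w = - x w. Proof. exact: L0_classE. Qed.
Let addE x y : \forall w \ae P, L0_add x y w = x w + y w.
Proof. exact: L0_classE. Qed.
Let mulE x y : \forall w \ae P, L0_mul x y w = x w * y w.
Proof. exact: L0_classE. Qed.

Let addA : associative L0_add.
Proof.
move=> x y z; apply/L0_eqP.
apply: filter_app (addE x (L0_add y z)); apply: filter_app (addE y z).
apply: filter_app (addE (L0_add x y) z); apply: filter_app (addE x y).
by apply: aeW => w -> -> -> ->; rewrite addrA.
Qed.

Let addC : commutative L0_add.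
Proof. by move=> x y; rewrite /L0_add addrC. Qed.

Let add0 : left_id L0_zero L0_add.
Proof.
move=> x; apply/L0_eqP; apply: filterS2 (addE L0_zero x) zeroE => w -> ->.
by rewrite add0r.
Qed.

Let addN : left_inverse L0_zero L0_opp L0_add.
Proof.
move=> x; apply/L0_eqP.
apply: filterS3 (addE (L0_opp x) x) (oppE x) zeroE => w -> -> ->.
by rewrite addNr.
Qed.

HB.instance Definition _ := GRing.isZmodule.Build (L0 P) addA addC add0 addN.

Let mulA : associative L0_mul.
Proof.
move=> x y z; apply/L0_eqP.
apply: filter_app (mulE x (L0_mul y z)); apply: filter_app (mulE y z).
apply: filter_app (mulE (L0_mul x y) z); apply: filter_app (mulE x y).
by apply: aeW => w -> -> -> ->; rewrite mulrA.
Qed.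

Let mulC : commutative L0_mul.
Proof. by move=> x y; rewrite /L0_mul mulrC. Qed.

Let mul1 : left_id L0_one L0_mul.
Proof.
move=> x; apply/L0_eqP; apply: filterS2 (mulE L0_one x) oneE => w -> ->.
by rewrite mul1r.
Qed.

Let mulD : left_distributive L0_mul L0_add.
Proof.
move=> x y z; apply/L0_eqP.
apply: filter_app (mulE (L0_add x y) z); apply: filter_app (addE x y).
apply: filter_app (addE (L0_mul x z) (L0_mul y z)).
apply: filter_app (mulE x z); apply: filter_app (mulE y z).
by apply: aeW => w -> -> -> -> ->; rewrite mulrDl.
Qed.

Lemma ae_exists (Q : T -> Prop) : (\forall w \ae P, Q w) -> exists w, Q w.
Proof.
have PF : ProperFilter (almost_everywhere P).
  by apply: ae_properfilter_algebraOfSetsType; rewrite [X in (_ < X)%E]probability_setT lte01.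
exact: filter_ex.
Qed.

Let one_neq0 : L0_one != 0.
Proof.
apply/eqP => /L0_eqP h.
have [] // : exists w : T, False.
apply: ae_exists; apply: filterS3 h oneE zeroE => w -> -> /eqP.
by rewrite oner_eq0.
Qed.

HB.instance Definition _ :=
  GRing.Zmodule_isComNzRing.Build (L0 P) mulA mulC mul1 mulD one_neq0.

Lemma L0_0E : \forall w \ae P, (0 : L0 P) w = 0. Proof. exact: zeroE. Qed.
Lemma L0_1E : \forall w \ae P, (1 : L0 P) w = 1. Proof. exact: oneE. Qed.
Lemma L0_oppE x : \forall w \ae P, (- x : L0 P) w = - x w. Proof. exact: oppE. Qed.
Lemma L0_addE x y : \forall w \ae P, (x + y : L0 P) w = x w + y w.
Proof. exact: addE. Qed.
Lemma L0_mulE x y : \forall w \ae P, (x * y : L0 P) w = x w * y w.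
Proof. exact: mulE. Qed.

Definition L0_le x y : bool := `[< \forall w \ae P, x w <= y w >].

Let L0_le_refl : reflexive L0_le.
Proof. by move=> x; apply/asboolP/aeW => w. Qed.

Let L0_le_anti : antisymmetric L0_le.
Proof.
move=> x y /andP[/asboolP xy /asboolP yx]; apply/L0_eqP.
by apply: filterS2 xy yx => w xy yx; apply/le_anti/andP.
Qed.

Let L0_le_trans : transitive L0_le.
Proof.
move=> y x z /asboolP xy /asboolP yz; apply/asboolP.
by apply: filterS2 xy yz => w; exact: le_trans.
Qed.

HB.instance Definition _ := Order.Le_isPOrder.Build ring_display (L0 P)
  L0_le_refl L0_le_anti L0_le_trans.

Lemma L0_leP x y : reflect (\forall w \ae P, x w <= y w) (x <= y).
Proof. exact: asboolP. Qed.

Definition L0_abs x : L0 P := L0_class (@Num.Def.normr R R \o repr x).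

Lemma L0_absE x : \forall w \ae P, L0_abs x w = `|x w|.
Proof. exact: L0_classE. Qed.

(* The set $L^0_{++}$. The strict order [0 < x] derived from the partial order on
   [L0 P] is weaker: it only means [0 <= x] and [x != 0]. *)
Definition L0_pos : set (L0 P) := [set x | \forall w \ae P, 0 < x w].

Definition L0_indic (A : set T) (mA : measurable A) : L0 P :=
  L0_class (indic_mfun A mA).

End L0_theory.
Arguments L0_class {d T R} P f.
Arguments L0_indic {d T R} P {A} mA.

Section eL0_theory.
Context d (T : measurableType d) (R : realType) (P : probability T R).
Local Open Scope ereal_scope.
Implicit Types (x y z : eL0 P) (A : set (eL0 P)).

Definition eL0_class (f : {mfun T >-> \bar R}) : eL0 P := \pi_(eL0 P) f.

Lemma eL0_classE f : \forall w \ae P, eL0_class f w = f w.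
Proof. exact: aeEqMfun_piE. Qed.

Lemma eL0_eqP x y : (\forall w \ae P, x w = y w) <-> x = y.
Proof. exact: aeEqMfun_eqP. Qed.

Definition eL0_le x y : bool := `[< \forall w \ae P, x w <= y w >].

Let eL0_le_refl : reflexive eL0_le.
Proof. by move=> x; apply/asboolP/aeW => w. Qed.

Let eL0_le_anti : antisymmetric eL0_le.
Proof.
move=> x y /andP[/asboolP xy /asboolP yx]; apply/eL0_eqP.
by apply: filterS2 xy yx => w xy yx; apply/le_anti/andP.
Qed.

Let eL0_le_trans : transitive eL0_le.
Proof.
move=> y x z /asboolP xy /asboolP yz; apply/asboolP.
by apply: filterS2 xy yz => w; exact: le_trans.
Qed.

HB.instance Definition _ := Order.Le_isPOrder.Build ring_display (eL0 P)
  eL0_le_refl eL0_le_anti eL0_le_trans.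

Lemma eL0_leP x y : reflect (\forall w \ae P, x w <= y w) (x <= y)%R.
Proof. exact: asboolP. Qed.

Lemma eL0_measurable x : measurable_fun setT x.
Proof. exact: (measurable_funP (repr x)). Qed.

Lemma L0_measurable (x : L0 P) : measurable_fun setT x.
Proof. exact: (measurable_funP (repr x)). Qed.

Definition eL0_mk (f : T -> \bar R) (mf : measurable_fun setT f) : eL0 P :=
  eL0_class (mfun_Sub (mem_set mf)).

Lemma eL0_mkE f (mf : measurable_fun setT f) :
  \forall w \ae P, eL0_mk mf w = f w.
Proof. exact: eL0_classE. Qed.

Definition eL0_cst (a : \bar R) : eL0 P := eL0_mk (@measurable_cst _ _ T _ setT a).

Lemma eL0_cstE a : \forall w \ae P, eL0_cst a w = a.
Proof. exact: eL0_mkE. Qed.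

Lemma L0_EFin_measurable (x : L0 P) : measurable_fun setT (EFin \o x).
Proof. by apply/measurable_EFinP; exact: L0_measurable. Qed.
Definition eL0_of (x : L0 P) : eL0 P := eL0_mk (@L0_EFin_measurable x).

Lemma eL0_ofE (x : L0 P) : \forall w \ae P, eL0_of x w = (x w)%:E.
Proof. exact: eL0_mkE. Qed.

(* The dual addition of \bar R is used so that +oo + (-oo) = +oo; the
   multiplication of \bar R satisfies 0 * (+oo) = 0 * (-oo) = 0. *)
Lemma eL0_add_measurable x y : measurable_fun setT (fun w => (x w + y w)%dE).
Proof.
under eq_fun do rewrite DualAddTheoryNumDomain.dual_addeE.
apply: measurableT_comp; first exact: oppe_measurable.
by apply: emeasurable_funD; apply: measurableT_comp => //; exact: eL0_measurable.
Qed.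
Definition eL0_add x y : eL0 P := eL0_mk (@eL0_add_measurable x y).

Lemma eL0_addE x y : \forall w \ae P, eL0_add x y w = (x w + y w)%dE.
Proof. exact: eL0_mkE. Qed.

Lemma eL0_opp_measurable x : measurable_fun setT (fun w => - x w).
Proof. by apply: measurableT_comp => //; exact: eL0_measurable. Qed.
Definition eL0_opp x : eL0 P := eL0_mk (@eL0_opp_measurable x).

Lemma eL0_oppE x : \forall w \ae P, eL0_opp x w = - x w.
Proof. exact: eL0_mkE. Qed.

Lemma eL0_scale_measurable (xi : L0 P) x :
  measurable_fun setT (fun w => (xi w)%:E * x w).
Proof.
by apply: emeasurable_funM; [exact: L0_EFin_measurable|exact: eL0_measurable].
Qed.
Definition eL0_scale (xi : L0 P) x : eL0 P := eL0_mk (@eL0_scale_measurable xi x).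

Lemma eL0_scaleE (xi : L0 P) x :
  \forall w \ae P, eL0_scale xi x w = (xi w)%:E * x w.
Proof. exact: eL0_mkE. Qed.

(* [supremum] is a least upper bound as soon as there is one, and every set has
   one by [eL0_supP] below; the supremum of the empty set is -oo. *)
Definition eL0_sup A : eL0 P := supremum (eL0_cst -oo) A.

End eL0_theory.

Section eL0_sup_theory.
Context d (T : measurableType d) (R : realType) (P : probability T R).
Local Open Scope ereal_scope.

Lemma ess_bigcup (S : set (set T)) : S `<=` measurable -> S !=set0 ->
  exists2 F : nat -> set T, (forall n, S (F n)) &
    forall A, S A -> P (A `\` \bigcup_n F n) = 0.
Proof.
move=> mS [S0 SS0].
pose V := [set P (\bigcup_n F n) | F in [set F : nat -> set T | forall n, S (F n)]].
pose M := ereal_sup V.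
have V0 : V (P (\bigcup_(n : nat) S0)) by exists (fun=> S0).
have VM (F : nat -> set T) : (forall n, S (F n)) -> P (\bigcup_n F n) <= M.
  by move=> SF; apply: ereal_sup_ubound; exists F.
have M0 : 0 <= M by apply: le_trans (ereal_sup_ubound V0).
have M1 : M <= 1.
  apply: ge_ereal_sup => _ [F SF <-]; apply: probability_le1.
  by apply: bigcup_measurable => n _; exact/mS/SF.
have Mfin : M \is a fin_num.
  by rewrite ge0_fin_numE// (le_lt_trans M1)// ltry.
have /choice[F_ HF] (k : nat) : exists F : nat -> set T,
    (forall n, S (F n)) /\ M - (k.+1%:R^-1)%:E < P (\bigcup_n F n).
  have k0 : (0 < k.+1%:R^-1 :> R)%R by rewrite invr_gt0.
  by have [_ [F SF <-] ltF] := ub_ereal_sup_adherent k0 Mfin; exists F.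
pose F n := if (unpickle n : option (nat * nat)) is Some kj then F_ kj.1 kj.2
            else S0.
have SF n : S (F n) by rewrite /F; case: unpickle => [kj|//]; exact: (HF _).1.
have mU : measurable (\bigcup_n F n).
  by apply: bigcup_measurable => n _; exact/mS/SF.
exists F => // A SA.
have MU : M <= P (\bigcup_n F n).
  apply/lee_addgt0Pr => e e0.
  have [k ke] : exists k : nat, (k.+1%:R^-1 < e)%R.
    by have [k _ /(_ _ (leqnn k))] := near_infty_natSinv_lt (PosNum e0); exists k.
  rewrite -leeBlDr//; apply: (@le_trans _ _ (M - (k.+1%:R^-1)%:E)).
    by rewrite leeB// lee_fin ltW.
  apply: (le_trans (ltW (HF k).2)); apply: le_measure; rewrite ?inE//.
    by apply: bigcup_measurable => n _; exact/mS/(HF k).1.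
  move=> w [j _ wj]; exists (pickle (k, j)) => //.
  by rewrite /F pickleK.
have mA := mS _ SA.
apply/eqP; rewrite eq_le measure_ge0 andbT.
have : P (\bigcup_n F n) + P (A `\` \bigcup_n F n) <= P (\bigcup_n F n).
  rewrite -measureU//; last 2 first.
  - exact: measurableD.
  - by rewrite setDE setICA setICr setI0.
  apply: le_trans MU.
  pose F' n := if n is m.+1 then F m else A.
  suff -> : \bigcup_n F n `|` A `\` \bigcup_n F n = \bigcup_n F' n.
    by apply: VM => -[|n] /=.
  apply/seteqP; split => [w [[n _ wn]|[wA _]]|w [[|n] _ wn]].
  - by exists n.+1.
  - by exists 0%N.
  - by have [Uw|nUw] := pselect ((\bigcup_n F n) w); [left|right].
  - by left; exists n.
rewrite -[X in _ <= X]adde0 leeD2lE// fin_numE.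
by rewrite -fin_numE fin_num_measure.
Qed.

Lemma rat_between (x y : \bar R) : x < y -> exists q : rat, x < (ratr q)%:E < y.
Proof.
case: x y => [x| |] [y| |]//=; rewrite ?lte_fin => xy.
- by have [q /[!in_itv]/= xqy] := rat_in_itvoo xy; exists q; rewrite !lte_fin.
- have /rat_in_itvoo[q /[!in_itv]/= /andP[xq _]] : (x < x + 1)%R.
    by rewrite ltrDl.
  by exists q; rewrite lte_fin xq ltry.
- have /rat_in_itvoo[q /[!in_itv]/= /andP[_ xq]] : (y - 1 < y)%R.
    by rewrite ltrBlDr ltrDl.
  by exists q; rewrite lte_fin xq ltNyr.
- by exists 0%R; rewrite ltNyr ltry.
Qed.

Lemma eL0_supremums_neq0 (A : set (eL0 P)) : A !=set0 -> supremums A !=set0.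
Proof.
move=> [f0 Af0].
have /choice[g_ Hg] (q : rat) : exists g : nat -> eL0 P, (forall n, A (g n)) /\
    forall f, A f -> P ([set w | (ratr q)%:E < f w] `\`
                        \bigcup_n [set w | (ratr q)%:E < g n w]) = 0.
  pose S := [set [set w | (ratr q)%:E < (f : eL0 P) w] | f in A].
  have mS : S `<=` measurable.
    move=> _ [f Af <-]; rewrite -[X in measurable X]setTI.
    by apply: emeasurable_fun_o_infty => //; exact: eL0_measurable.
  have S0 : S !=set0 by exists [set w | (ratr q)%:E < f0 w]; exists f0.
  have [F SF HF] := ess_bigcup mS S0.
  have /choice[g Hg] (n : nat) : exists f : eL0 P,
    A f /\ [set w | (ratr q)%:E < f w] = F n.
    by have [f] := SF n; exists f.
  exists g; split => [n|f Af]; first exact: (Hg n).1.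
  under eq_bigcupr do rewrite (Hg _).2.
  by apply: HF; exists f.
pose h n := if (unpickle n : option (rat * nat)) is Some qn then g_ qn.1 qn.2
            else f0.
have Ah n : A (h n) by rewrite /h; case: unpickle => [qn|//]; exact: (Hg _).1.
have ms : measurable_fun setT (fun w => esups (fun n => h n w) 0%N).
  by apply: measurable_fun_esups => n; exact: eL0_measurable.
have esupsE w : esups (fun n => h n w) 0%N = ereal_sup (range (fun n => h n w)).
  rewrite /esups/= /sdrop; congr ereal_sup; apply/seteqP.
  by split => _ [n _ <-]; exists n.
exists (eL0_mk P ms); split => [f Af|b Ub]; apply/eL0_leP.
- move: (f : eL0 P) Af => {}f Af.
  have Hq (q : rat) : \forall w \ae P, (ratr q)%:E < f w ->
      exists n, (ratr q)%:E < g_ q n w.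
    exists ([set w | (ratr q)%:E < f w] `\`
            \bigcup_n [set w | (ratr q)%:E < g_ q n w]); split.
    + apply: measurableD; last (apply: bigcup_measurable => n _).
        rewrite -[X in measurable X]setTI.
        by apply: emeasurable_fun_o_infty => //; exact: eL0_measurable.
      rewrite -[X in measurable X]setTI.
      by apply: emeasurable_fun_o_infty => //; exact: eL0_measurable.
    + exact: (Hg q).2.
    + by move=> w /= /not_implyP[fw /forallNP nw]; split => // -[n _ /nw].
  have : \forall w \ae P, forall k, if unpickle k is Some q
      then (ratr q)%:E < f w -> exists n, (ratr q)%:E < g_ q n w else True.
    by apply: ae_foralln => k; case: unpickle => [q|]; [exact: Hq|exact: aeW].
  apply: filterS2 (eL0_mkE P ms) => w -> Hw.
  rewrite leNgt; apply/negP => /rat_between[q /andP[sq qf]].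
  have := Hw (pickle q); rewrite pickleK => /(_ qf)[n qn].
  have := lt_trans sq qn; apply/negP; rewrite -leNgt esupsE.
  by apply: ereal_sup_ubound; exists (pickle (q, n)) => //; rewrite /h pickleK.
- move: (b : eL0 P) Ub => {}b Ub.
  have : \forall w \ae P, forall n, h n w <= b w.
    by apply: ae_foralln => n; apply/eL0_leP/Ub.
  apply: filterS2 (eL0_mkE P ms) => w -> Hw.
  by rewrite esupsE; apply: ge_ereal_sup => _ [n _ <-].
Qed.

Lemma eL0_supP (A : set (eL0 P)) : supremums A (eL0_sup A).
Proof.
have [->|/set0P/[dup] A0 /eL0_supremums_neq0[s As]] := eqVneq A set0.
  rewrite /eL0_sup supremum0; split => // b _; apply/eL0_leP.
  by apply: filterS (eL0_cstE P -oo) => w ->; exact: leNye.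
rewrite /eL0_sup /supremum; case: ifPn => [/eqP A0'|_].
  by move: A0; rewrite A0' => -[].
by case: xgetP => [y _ //|/(_ s)].
Qed.

Lemma eL0_sup_le (A : set (eL0 P)) (b : eL0 P) :
  (eL0_sup A <= b)%R <-> ubound A b.
Proof.
have [sub slb] := eL0_supP A; split=> [sb x Ax|]; last exact: slb.
by apply: le_trans sb; exact: sub.
Qed.

Lemma eL0_of_le (x y : L0 P) : (eL0_of x <= eL0_of y)%R <-> (x <= y)%R.
Proof.
split=> [/eL0_leP xy|/L0_leP xy].
  apply/L0_leP; apply: filterS3 xy (eL0_ofE x) (eL0_ofE y) => w + xw yw.
  by rewrite xw yw lee_fin.
apply/eL0_leP; apply: filterS3 xy (eL0_ofE x) (eL0_ofE y) => w + xw yw.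
by rewrite xw yw lee_fin.
Qed.

End eL0_sup_theory.

Definition L0_seminorm d (T : measurableType d) (R : realType)
    (P : probability T R) (E : lmodType (L0 P)) (p : E -> L0 P) : Prop :=
  [/\ forall x, 0 <= p x,
      forall (xi : L0 P) x, p (xi *: x) = L0_abs xi * p x &
      forall x y, p (x + y) <= p x + p y].

HB.mixin Record isRandomLocallyConvex d (T : measurableType d) (R : realType)
    (P : probability T R) (E : Type) of GRing.Lmodule (L0 P) E := {
  L0_seminorms : set (E -> L0 P) ;
  L0_seminormsP : forall p, L0_seminorms p -> L0_seminorm p ;
  L0_seminorms_sep : forall x : E,
    eL0_sup [set eL0_of (p x) | p in L0_seminorms] = eL0_of 0 <-> x = 0
}.

#[short(type="rlcModType")]
HB.structure Definition RandomLocallyConvex d (T : measurableType d)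
    (R : realType) (P : probability T R) :=
  {E of isRandomLocallyConvex d T R P E & GRing.Lmodule (L0 P) E}.

Arguments L0_seminorms {d T R P} E _ : rename.

Section Tc_topology.
Context d (T : measurableType d) (R : realType) (P : probability T R).
Variable E : rlcModType P.
Implicit Types (Q : set (E -> L0 P)) (e : L0 P) (x y : E).

(* The basic neighborhood of 0 given by a finite Q and e > 0 a.s. *)
Definition L0_ball Q e : set E :=
  [set x | eL0_sup [set eL0_of (p x) | p in Q] <= eL0_of e].

Lemma L0_ballP Q e x : L0_ball Q e x <-> (forall p, Q p -> p x <= e).
Proof.
split=> [/eL0_sup_le ub p Qp|h].
  by apply/eL0_of_le; apply: ub; exists p.
by apply/eL0_sup_le => _ [p Qp <-]; apply/eL0_of_le/h.
Qed.

(* A copy of E carrying the topology T_c. *)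
Definition Tc : Type := E.
HB.instance Definition _ := GRing.Lmodule.on Tc.

Definition Tc_nbhs (x : Tc) : set_system Tc :=
  [set A | exists Q e, [/\ finite_set Q, Q `<=` L0_seminorms E,
     L0_pos e & forall y : E, L0_ball Q e (y - x) -> A y]].

HB.instance Definition _ := hasNbhs.Build Tc Tc_nbhs.

Let L0_seminorm0 p : L0_seminorm p -> p (0 : E) = 0.
Proof.
move=> [_ pZ _]; rewrite -(scale0r (0 : E)) pZ.
suff -> : L0_abs (0 : L0 P) = 0 by rewrite mul0r.
apply/L0_eqP; apply: filterS2 (L0_absE (0 : L0 P)) (L0_0E P) => w -> ->.
by rewrite normr0.
Qed.

Let L0_pos_ge0 e : L0_pos e -> 0 <= e.
Proof.
move=> e0; apply/L0_leP; apply: filterS2 e0 (L0_0E P) => w e0 ->.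
exact: ltW.
Qed.

Let Tc_nbhs_point x A : Tc_nbhs x A -> A x.
Proof.
move=> [Q [e [_ QE e0 QA]]]; apply: QA; apply/L0_ballP => p Qp.
by rewrite subrr (L0_seminorm0 (L0_seminormsP p (QE _ Qp))) L0_pos_ge0.
Qed.

Let Tc_nbhs_filter (x : Tc) : ProperFilter (nbhs x).
Proof.
apply: Build_ProperFilter_ex => [A /Tc_nbhs_point Ax|]; first by exists x.
split.
- exists set0, 1; split => //.
  by apply: filterS (L0_1E P) => w ->.
- move=> A B [Q1 [e1 [fQ1 Q1E e10 QA]]] [Q2 [e2 [fQ2 Q2E e20 QB]]].
  pose e := L0_class P (min_mfun (repr e1) (repr e2)).
  have eE : \forall w \ae P, e w = Num.min (e1 w) (e2 w) by exact: L0_classE.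
  exists (Q1 `|` Q2), e; split.
  + by rewrite finite_setU.
  + by move=> p [/Q1E|/Q2E].
  + apply: filterS3 eE e10 e20 => w -> w1 w2.
    by rewrite lt_min w1 w2.
  + move=> y /L0_ballP ye; split; [apply: QA|apply: QB]; apply/L0_ballP => p Qp.
    * apply: (le_trans (ye p (or_introl Qp))); apply/L0_leP.
      by apply: filterS eE => w ->; rewrite ge_min lexx.
    * apply: (le_trans (ye p (or_intror Qp))); apply/L0_leP.
      by apply: filterS eE => w ->; rewrite ge_min lexx orbT.
- move=> A B AB [Q [e [fQ QE e0 QA]]]; exists Q, e; split => // y /QA; exact: AB.
Qed.

Let Tc_nbhs_nbhs (x : Tc) (A : set Tc) : nbhs x A -> nbhs x (nbhs^~ A).
Proof.
move=> [Q [e [fQ QE e0 QA]]].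
pose h : L0 P := L0_class P (cst 2^-1 : T -> R) * e.
have hE : \forall w \ae P, h w = 2^-1 * e w.
  apply: filterS2 (L0_mulE (L0_class P (cst 2^-1 : T -> R)) e)
    (L0_classE P (cst 2^-1 : T -> R)) => w.
  by rewrite /h => -> ->.
have h0 : L0_pos h.
  by apply: filterS2 hE e0 => w -> ew; rewrite mulr_gt0.
have hhe : h + h = e.
  apply/L0_eqP; apply: filterS2 (L0_addE h h) hE => w -> ->.
  by rewrite -mulrDl -[2^-1 + 2^-1]/(2^-1 *+ 2) -(mulr_natl 2^-1) divff ?mul1r.
exists Q, h; split => // y /L0_ballP yx; exists Q, h; split => // z /L0_ballP zy.
apply: QA; apply/L0_ballP => p Qp.
have [_ _ pD] := L0_seminormsP p (QE _ Qp).
rewrite -(subrK y z) -addrA (le_trans (pD _ _))// -hhe.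
apply/L0_leP; have /L0_leP h1 := yx p Qp; have /L0_leP h2 := zy p Qp.
apply: filter_app (L0_addE (p (z - y)) (p (y - x))).
apply: filter_app (L0_addE h h).
by apply: filterS2 h1 h2 => w h1 h2 -> ->; apply: lerD.
Qed.

HB.instance Definition _ := Nbhs_isNbhsTopological.Build Tc
  Tc_nbhs_filter Tc_nbhs_point Tc_nbhs_nbhs.

End Tc_topology.

(* $L^0$ as a module over itself, with the single seminorm |.| *)
Section L0_regular.
Context d (T : measurableType d) (R : realType) (P : probability T R).

Let L0_abs_seminorm : L0_seminorm (@L0_abs _ _ _ P : (L0 P)^o -> L0 P).
Proof.
split=> [x|xi x|x y].
- apply/L0_leP; apply: filterS2 (L0_0E P) (L0_absE x) => w -> ->.
  exact: normr_ge0.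
- apply/L0_eqP; rewrite [_ *: _]/(xi * x).
  apply: filter_app (L0_absE (xi * x)); apply: filter_app (L0_mulE xi x).
  apply: filter_app (L0_mulE (L0_abs xi) (L0_abs x)).
  apply: filterS2 (L0_absE xi) (L0_absE x) => w -> -> -> -> ->.
  exact: normrM.
- apply/L0_leP.
  apply: filter_app (L0_absE (x + y)); apply: filter_app (L0_addE x y).
  apply: filter_app (L0_addE (L0_abs x) (L0_abs y)).
  apply: filterS2 (L0_absE x) (L0_absE y) => w -> -> -> -> ->.
  exact: ler_normD.
Qed.

Let L0_abs_seminorms (p : (L0 P)^o -> L0 P) :
  [set @L0_abs _ _ _ P] p -> L0_seminorm p.
Proof. by move=> ->; exact: L0_abs_seminorm. Qed.

Let L0_abs_sep (x : (L0 P)^o) :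
  eL0_sup [set eL0_of (p x) | p in [set @L0_abs _ _ _ P]] = eL0_of 0 <-> x = 0.
Proof.
rewrite image_set1 /eL0_sup supremum1.
split=> [/eL0_eqP h|->].
  apply/L0_eqP.
  apply: filter_app h; apply: filter_app (eL0_ofE (L0_abs x)).
  apply: filter_app (eL0_ofE (0 : L0 P)); apply: filter_app (L0_absE x).
  by apply: filterS (L0_0E P) => w -> -> -> -> [] /eqP; rewrite normr_eq0 => /eqP.
congr eL0_of; apply/L0_eqP.
by apply: filterS2 (L0_absE (0 : L0 P)) (L0_0E P) => w -> ->; rewrite normr0.
Qed.

HB.instance Definition _ := isRandomLocallyConvex.Build d T R P (L0 P)^o
  L0_abs_seminorms L0_abs_sep.

End L0_regular.

Section random_locally_convex_defs.
Context d (T : measurableType d) (R : realType) (P : probability T R).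
Variable E : rlcModType P.
Implicit Types (G B : set E) (f : E -> eL0 P).

(* Pieces of the partition may be empty, so finite partitions are covered. *)
Definition countable_concatenation G : Prop :=
  forall (x_ : nat -> E) (A_ : nat -> set T) (mA : forall n, measurable (A_ n)),
    (forall n, G (x_ n)) -> trivIset setT A_ -> \bigcup_n A_ n = setT ->
    exists2 x, G x & forall n, L0_indic P (mA n) *: x = L0_indic P (mA n) *: x_ n.

Definition L0_balanced B : Prop :=
  forall (eta : L0 P) x, L0_abs eta <= 1 -> B x -> B (eta *: x).

Definition L0_convex B : Prop :=
  forall x y (xi : L0 P), B x -> B y -> 0 <= xi -> xi <= 1 ->
    B (xi *: x + (1 - xi) *: y).

Definition L0_absorbent B : Prop :=
  forall x, exists2 xi : L0 P, L0_pos xi &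
    forall eta : L0 P, L0_abs eta <= xi -> B (eta *: x).

Definition L0_barrel B : Prop :=
  [/\ closed (B : set (Tc E)), L0_balanced B, L0_convex B & L0_absorbent B].

Definition L0_prebarreled : Prop :=
  forall B, L0_barrel B -> countable_concatenation B -> nbhs (0 : Tc E) B.

Definition conjugate_space : set {linear E -> (L0 P)^o} :=
  [set u | continuous (u : Tc E -> Tc (L0 P)^o)].

Definition dom f : set E := [set x | \forall w \ae P, (f x w < +oo)%E].

Definition is_proper f : Prop :=
  dom f !=set0 /\ forall x, \forall w \ae P, (-oo < f x w)%E.

Definition L0_convex_fun f : Prop :=
  forall x y (xi : L0 P), 0 <= xi -> xi <= 1 ->
    f (xi *: x + (1 - xi) *: y) <=
      eL0_add (eL0_scale xi (f x)) (eL0_scale (1 - xi) (f y)).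

Definition Tc_lsc f : Prop :=
  forall r : L0 P, closed ([set x | f x <= eL0_of r] : set (Tc E)).

Definition subdifferential f x : set {linear E -> (L0 P)^o} :=
  [set u | conjugate_space u /\
     forall y, eL0_of (u (y - x)) <= eL0_add (f y) (eL0_opp (f x))].

End random_locally_convex_defs.

(* Main.v *)
Require Import Defs.
From HB Require Import structures.
From mathcomp Require Import all_boot all_order all_algebra generic_quotient.
From mathcomp Require Import all_classical all_reals all_analysis.
From mathcomp Require Import measurable_realfun ring lra.
Set Implicit Arguments.
Unset Strict Implicit.
Unset Printing Implicit Defensive.
Import Order.TTheory GRing.Theory Num.Theory.
Import numFieldNormedType.Exports.
Import DualAddTheory.

Local Open Scope classical_set_scope.
Local Open Scope ring_scope.

(* Set r0 = f x. The pairs (y, c) such that f(x + t y) <= r0 + t c for some t in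
   L0_{++} form a cone in E x L0, the epigraph of the directional derivative of f
   at x; it is salient in the sense that it contains (0, c) only for c >= 0, and
   it projects onto E because x is interior to dom f. By Zorn's lemma it lies in
   a maximal salient cone K. With r(z) the essential infimum of the c such that
   (z, c) is in K, adding the half-line through (-z, -r(z)) keeps K salient, so
   K contains both (z, r(z)) and (-z, -r(z)); hence r is additive and homogeneous
   for the scalars in L0_{++}, and every scalar is a difference of two of those.
   This linear r is the subgradient. For continuity, the set of the y such that
   f(x + y) and f(x - y) are at most r0 + 1 is an L0-barrel with the countable
   concatenation property, so it is a neighborhood of 0, and |r| <= 1 there. *)

(* Replaces a compound element of L0 that is evaluated under [\forall w \ae P]
   by a variable whose value is given by an almost sure equation. *)
Ltac L0_eval_step :=
  match goal with
  | |- context [@L0_fun ?d ?T ?R ?P ?z] =>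
    let H := fresh "H" in
    match z with
    | @GRing.zero _ =>
      have H : \forall w \ae P, L0_fun z w = 0 := L0_0E P
    | @GRing.one _ =>
      have H : \forall w \ae P, L0_fun z w = 1 := L0_1E P
    | @GRing.opp _ ?a =>
      have H : \forall w \ae P, L0_fun z w = - L0_fun a w := L0_oppE a
    | @GRing.add _ ?a ?b =>
      have H : \forall w \ae P, L0_fun z w = L0_fun a w + L0_fun b w :=
        L0_addE a b
    | @GRing.mul _ ?a ?b =>
      have H : \forall w \ae P, L0_fun z w = L0_fun a w * L0_fun b w :=
        L0_mulE a b
    | L0_abs ?a => have H := L0_absE a
    end;
    let s := fresh "z_eval" in
    move: H; generalize z => s; apply: filter_app
  | |- context [@eL0_fun ?d ?T ?R ?P ?z] =>
    let H := fresh "H" in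
    match z with
    | eL0_of ?a => have H := eL0_ofE a
    | eL0_add ?a ?b => have H := eL0_addE a b
    | eL0_opp ?a => have H := eL0_oppE a
    | eL0_scale ?a ?b => have H := eL0_scaleE a b
    end;
    let s := fresh "z_eval" in
    move: H; generalize z => s; apply: filter_app
  end.

Ltac L0_eval := repeat L0_eval_step; let w := fresh "w" in apply: aeW => w;
  repeat match goal with |- _ = _ -> _ => move=> -> end.

(** * Order, inverses and essential infima in [L0 P] *)

Section L0_arithmetic.
Context d (T : measurableType d) (R : realType) (P : probability T R).
Implicit Types (a b c s t : L0 P).

Lemma L0_mk_exists (h : T -> R) : measurable_fun setT h ->
  exists a : L0 P, \forall w \ae P, a w = h w.
Proof.
by move=> mh; exists (L0_class P (mfun_Sub (mem_set mh))); exact: L0_classE.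
Qed.

Lemma L0_pos1 : L0_pos (1 : L0 P).
Proof. by rewrite /L0_pos /=; L0_eval. Qed.

Lemma L0_posD s t : L0_pos s -> L0_pos t -> L0_pos (s + t).
Proof.
move=> s0 t0; rewrite /L0_pos /=.
by apply: filter_app s0; apply: filter_app t0; L0_eval => *; apply: addr_gt0.
Qed.

Lemma L0_posM s t : L0_pos s -> L0_pos t -> L0_pos (s * t).
Proof.
move=> s0 t0; rewrite /L0_pos /=.
by apply: filter_app s0; apply: filter_app t0; L0_eval => *; apply: mulr_gt0.
Qed.

Lemma L0_pos_inv t : L0_pos t -> exists2 s, L0_pos s & t * s = 1.
Proof.
move=> t0.
(* The power -1 is measurable on all of [R] and equals the inverse where [t] is positive, hence
   almost surely. *)
have [|s sE] := @L0_mk_exists (fun w => t w `^ -1).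
  apply: (@measurableT_comp _ _ _ _ _ _ (@powR R ^~ (-1)) _ t).
    exact: measurable_powR.
  exact: L0_measurable.
exists s; first by apply: filterS2 t0 sE => w tw ->; rewrite powR_gt0.
apply/L0_eqP; apply: filter_app t0; apply: filter_app sE; L0_eval => t0.
by rewrite powR_inv1 ?ltW// divff ?gt_eqF.
Qed.

Lemma L0_pos_sub a : exists s t, [/\ L0_pos s, L0_pos t & a = s - t].
Proof.
exists (L0_abs a + 1 + a), (L0_abs a + 1); split.
- rewrite /L0_pos /=; L0_eval.
  have := ler_norm (- a w); rewrite normrN; lra.
- by rewrite /L0_pos /=; L0_eval; have := normr_ge0 (a w); lra.
- by rewrite addrAC subrr add0r.
Qed.

Lemma L0_subr_ge0 a b : (0 <= b - a) = (a <= b).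
Proof.
by apply/L0_leP/L0_leP => h; apply: filter_app h; L0_eval; rewrite subr_ge0.
Qed.

Lemma L0_addr_ge0 a b : 0 <= a -> 0 <= b -> 0 <= a + b.
Proof.
move=> /L0_leP a0 /L0_leP b0; apply/L0_leP.
by apply: filter_app a0; apply: filter_app b0; L0_eval => *; apply: addr_ge0.
Qed.

Lemma L0_mulr_ge0 a b : 0 <= a -> 0 <= b -> 0 <= a * b.
Proof.
move=> /L0_leP a0 /L0_leP b0; apply/L0_leP.
by apply: filter_app a0; apply: filter_app b0; L0_eval => *; apply: mulr_ge0.
Qed.

Lemma L0_lerNl a b : (- a <= b) = (- b <= a).
Proof. by rewrite -L0_subr_ge0 -[RHS]L0_subr_ge0 !opprK addrC. Qed.

Lemma L0_pos_ge0 t : L0_pos t -> 0 <= t.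
Proof.
by move=> t0; apply/L0_leP; apply: filter_app t0; L0_eval => /ltW.
Qed.

Lemma L0_pmulr_ge0 t a : L0_pos t -> 0 <= t * a -> 0 <= a.
Proof.
move=> t0 /L0_leP ta; apply/L0_leP; apply: filter_app t0; apply: filter_app ta.
by L0_eval => + t0; rewrite pmulr_rge0.
Qed.

Lemma L0_abs_le a b : L0_abs a <= b <-> - b <= a /\ a <= b.
Proof.
split=> [/L0_leP ab|[/L0_leP ba /L0_leP ab]].
  by split; apply/L0_leP; apply: filter_app ab; L0_eval;
    rewrite ler_norml => /andP[].
apply/L0_leP; apply: filter_app ab; apply: filter_app ba; L0_eval => ba ab.
by rewrite ler_norml ba.
Qed.

Lemma L0_indicE (A : set T) (mA : measurable A) :
  \forall w \ae P, L0_indic P mA w = \1_A w.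
Proof. exact: L0_classE. Qed.

Lemma L0_indic_bounds (A : set T) (mA : measurable A) :
  0 <= L0_indic P mA /\ L0_indic P mA <= 1.
Proof.
by split; apply/L0_leP; apply: filter_app (L0_indicE mA); L0_eval;
  rewrite indicE; case: (_ \in _).
Qed.

Lemma eL0_real (g : eL0 P) : (\forall w \ae P, (-oo < g w)%E) ->
  (\forall w \ae P, (g w < +oo)%E) -> exists a, eL0_of a = g.
Proof.
move=> gN gy; have [|a aE] := @L0_mk_exists (fine \o g).
  by apply: measurableT_comp => //; exact: eL0_measurable.
exists a; apply/eL0_eqP; apply: filter_app gN; apply: filter_app gy.
apply: filter_app aE; L0_eval => gy gN.
by rewrite /= fineK// fin_numE gt_eqF// lt_eqF.
Qed.

(** The infimum is minus the essential supremum of the negatives; that supremum is real-valued,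
    lying between [- c0] for some [c0] in [S] and [- b]. *)
Lemma L0_inf_exists (S : set (L0 P)) (b : L0 P) :
  S !=set0 -> (forall c, S c -> b <= c) ->
  exists r, (forall c, S c -> r <= c) /\
            (forall b', (forall c, S c -> b' <= c) -> b' <= r).
Proof.
move=> [c0 Sc0] Sb.
have N (a c : L0 P) : (eL0_of (- a) <= eL0_of (- c)) <-> (c <= a).
  by split => [/eL0_of_le|h]; last (apply/eL0_of_le); rewrite L0_lerNl opprK.
pose M := eL0_sup [set eL0_of (- c) | c in S].
have [ubM lubM] := eL0_supP [set eL0_of (- c) | c in S].
have Mb : M <= eL0_of (- b) by apply: lubM => _ [c Sc <-]; apply/N/Sb.
have Mc0 : eL0_of (- c0) <= M by apply: ubM; exists c0.
have [||a aM] := @eL0_real M.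
- move/eL0_leP: Mc0 => h; apply: filter_app h; L0_eval.
  exact/lt_le_trans/ltNyr.
- move/eL0_leP: Mb => h; apply: filter_app h; L0_eval => h.
  exact: le_lt_trans h (ltry _).
exists (- a); split=> [c Sc|b' Sb']; apply/N; rewrite opprK aM.
- by apply: ubM; exists c.
- by apply: lubM => _ [c Sc <-]; apply/N/Sb'.
Qed.

End L0_arithmetic.

(** * Maximal salient cones and the linear functional they define *)

Section separation.
Context d (T : measurableType d) (R : realType) (P : probability T R).
Variable E : lmodType (L0 P).
Implicit Types (K : set (E * L0 P)).

(** Only scalars in [L0_pos] act: they are invertible, so a factor can always be divided out. Since
    0 is not among them, the apex is listed separately. *)
Definition L0_cone K : Prop :=
  [/\ K (0, 0),
      forall y c y' c', K (y, c) -> K (y', c') -> K (y + y', c + c') &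
      forall (t : L0 P) y c, L0_pos t -> K (y, c) -> K (t *: y, t * c)].

Definition L0_salient K : Prop := forall c, K (0, c) -> 0 <= c.

(** Each cone axiom involves at most two points, and these lie in a common member of the chain, so
    Zorn's lemma applies to unions of chains. *)
Lemma maximal_salient_cone K0 : L0_cone K0 -> L0_salient K0 ->
  exists K, [/\ K0 `<=` K, L0_cone K, L0_salient K &
    forall K', K `<=` K' -> L0_cone K' -> L0_salient K' -> K' `<=` K].
Proof.
move=> K0cone K0sal.
(* The empty cone is admitted only to bound the empty chain. *)
pose good K := K !=set0 -> [/\ K0 `<=` K, L0_cone K & L0_salient K].
have [F Fgood Ftot|K [Kgood Kmax]] := @Zorn_bigcup _ good; last first.
  have [|K0K Kc Ks] := Kgood.
    apply/set0P/eqP => K_0; apply: (Kmax K0) => [|_]; last by split.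
    rewrite K_0; split=> // h; have [h00 _ _] := K0cone; exact: (h _ h00).
  exists K; split=> // K' KK' K'c K's.
  apply: contrapT => nK'K; apply: (Kmax K') => // _; split=> //.
  exact: subset_trans KK'.
move=> [p0 [X0 FX0 X0p0]].
have FE X : F X -> X !=set0 -> [/\ K0 `<=` X, L0_cone X & L0_salient X].
  by move=> FX; exact: Fgood.
have [K0X0 [X000 _ _] _] := FE _ FX0 (ex_intro _ _ X0p0).
split; [by move=> p /K0X0 X0p; exists X0| split|].
- by exists X0.
- move=> y c y' c' [X FX Xy] [X' FX' X'y].
  have [_ [_ XD _] _] := FE _ FX (ex_intro _ _ Xy).
  have [_ [_ X'D _] _] := FE _ FX' (ex_intro _ _ X'y).
  by have [XX'|X'X] := Ftot _ _ FX FX';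
    [exists X' => //; apply: X'D => //; exact: XX'
    |exists X => //; apply: XD => //; exact: X'X].
- move=> t y c t0 [X FX Xy]; have [_ [_ _ XZ] _] := FE _ FX (ex_intro _ _ Xy).
  by exists X => //; exact: XZ.
- by move=> c [X FX Xc]; have [_ _] := FE _ FX (ex_intro _ _ Xc); exact.
Qed.

Lemma L0_cone_separation K0 : L0_cone K0 -> L0_salient K0 ->
  (forall y, exists c, K0 (y, c)) ->
  exists u : {linear E -> (L0 P)^o}, forall y c, K0 (y, c) -> (u y : L0 P) <= c.
Proof.
move=> K0cone K0sal K0full.
have [K [K0K [K00 KD KZ] Ksal Kmax]] := maximal_salient_cone K0cone K0sal.
have /choice[r rP] (z : E) : exists r : L0 P, (forall c, K (z, c) -> r <= c) /\
    (forall b, (forall c, K (z, c) -> b <= c) -> b <= r).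
  have [c Kc] := K0full z; have [b Kb] := K0full (- z).
  apply: (@L0_inf_exists _ _ _ _ _ (- b)); first by exists c; apply: K0K.
  (* The points (z, c') and (- z, b) add up to (0, c' + b), so salience gives - b <= c'. *)
  move=> c' Kc'; rewrite -L0_subr_ge0 opprK; apply: Ksal.
  by rewrite -(subrr z); apply: KD => //; apply: K0K.
have rK z : K (- z, - r z).
  (* [K'] is [K] plus the half-line of all t * (- z, - r z); t = 0 is allowed so that [K'] contains
     [K]. *)
  pose K' := [set p : E * L0 P | exists t : L0 P, (t = 0 \/ L0_pos t) /\
    K (p.1 + t *: z, p.2 + t * r z)].
  apply: (Kmax K').
  - by move=> [y c] Kyc; exists 0; split; [left|rewrite scale0r mul0r !addr0].
  - split.
    + by exists 0; split; [left|rewrite scale0r mul0r !addr0].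
    + move=> y c y' c' [t [t0 Kt]] [t' [t'0 Kt']]; exists (t + t'); split.
        move: t0 t'0 => [->|t0] [->|t'0]; rewrite ?addr0 ?add0r; [left|right..] => //.
        exact: L0_posD.
      by rewrite /= scalerDl mulrDl (addrACA y) (addrACA c); exact: KD.
    + move=> s y c s0 [t [t0 Kt]]; exists (s * t); split.
        by move: t0 => [->|t0]; [left; rewrite mulr0|right; exact: L0_posM].
      by have := KZ _ _ _ s0 Kt; rewrite /= scalerDr mulrDr scalerA mulrA.
  - move=> c [t [[->|t0]]]; rewrite /= add0r; first by
      rewrite scale0r mul0r addr0; exact: Ksal.
    (* Division by t puts (z, c / t + r z) in [K]; since [r z] is a lower bound over z, c / t >=
       0. *)
    have [s s0 ts] := L0_pos_inv t0.
    move=> /(KZ _ _ _ s0); rewrite scalerA [s * t]mulrC ts scale1r.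
    move=> /(rP z).1; rewrite mulrDr mulrA [s * t]mulrC ts mul1r -L0_subr_ge0 addrK.
    exact: L0_pmulr_ge0.
  - exists 1; split; first by right; exact: L0_pos1.
    by rewrite /= scale1r mul1r !addNr.
have rN z : r (- z) = - r z.
  (* One inequality is [rK]. For the other, (- z, c) and (z, c') in [K] add up to (0, c + c'), so -
     c <= c'. *)
  apply/le_anti; rewrite (rP _).1//=; apply: (rP _).2 => c Kc.
  rewrite L0_lerNl; apply: (rP _).2 => c' Kc'.
  by rewrite -L0_subr_ge0 opprK; apply: Ksal; rewrite -(subrr z); exact: KD.
have Kr z : K (z, r z) by rewrite -[z in K (z, _)]opprK -[r z]opprK -rN; exact: rK.
have rDle y z : r (y + z) <= r y + r z by exact/(rP _).1/KD.
have rD y z : r (y + z) = r y + r z.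
  apply/le_anti/andP; split => //.
  have := rDle (y + z) (- z); rewrite addrK rN -L0_subr_ge0 => h.
  by rewrite -L0_subr_ge0; congr (0 <= _): h; ring.
have rZle t y : L0_pos t -> r (t *: y) <= t * r y.
  by move=> t0; apply/(rP _).1/KZ.
have rZpos t y : L0_pos t -> r (t *: y) = t * r y.
  move=> t0; apply/le_anti/andP; split; first exact: rZle.
  by have := rZle t (- y) t0; rewrite scalerN !rN mulrN L0_lerNl opprK.
have r_linear : linear (r : E -> (L0 P)^o).
  move=> a y z; have [s [t [s0 t0 ->]]] := L0_pos_sub a.
  rewrite rD scalerBl rD rN !rZpos//; congr (_ + _).
  by rewrite [RHS]mulrBl.
pose u : {linear E -> (L0 P)^o} :=
  HB.pack (r : E -> (L0 P)^o)
    (GRing.isLinear.Build _ _ _ _ (r : E -> (L0 P)^o) r_linear).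
by exists u => y c /K0K /(rP y).1.
Qed.

End separation.

(** * Balls of finitely many seminorms, and continuity *)

Section seminorms.
Context d (T : measurableType d) (R : realType) (P : probability T R).
Variable E : rlcModType P.
Implicit Types (Q : set (E -> L0 P)) (e : L0 P) (y : E).

Lemma L0_seminormN (p : E -> L0 P) y : L0_seminorm p -> p (- y) = p y.
Proof.
move=> [_ pZ _]; rewrite -scaleN1r pZ.
suff -> : L0_abs (-1 : L0 P) = 1 by rewrite mul1r.
by apply/L0_eqP; L0_eval; rewrite normrN1.
Qed.

(** One plus the sum of the finitely many values works; the 1 makes the bound invertible. *)
Lemma L0_seminorms_bounded Q y : finite_set Q -> Q `<=` L0_seminorms E ->
  exists2 m : L0 P, L0_pos m & forall p, Q p -> p y <= m.
Proof.
move=> /finite_seqP[qs ->]; elim: qs => [_|p qs IH QE].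
  by exists 1 => //; exact: L0_pos1.
have [|m m0 mP] := IH.
  by move=> q qs_q; apply: QE; rewrite /= inE qs_q orbT.
have /L0_seminormsP[p0 _ _] : L0_seminorms E p by apply: QE; rewrite /= inE eqxx.
exists (m + p y).
  move/L0_leP: (p0 y) => py; rewrite /L0_pos /=.
  apply: filter_app m0; apply: filter_app py; L0_eval => py m0.
  exact: ltr_wpDr.
move=> q; rewrite /= inE => /orP[/eqP ->|/mP qm].
  by rewrite -L0_subr_ge0 addrK; exact: L0_pos_ge0.
by rewrite -L0_subr_ge0 addrAC L0_addr_ge0// L0_subr_ge0.
Qed.

Lemma L0_ball_absorbs Q e y : finite_set Q -> Q `<=` L0_seminorms E ->
  L0_pos e -> exists t, [/\ L0_pos t, L0_ball Q e (t *: y) & L0_ball Q e (- (t *: y))].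
Proof.
move=> fQ QE e0; have [m m0 mP] := L0_seminorms_bounded y fQ QE.
have [s s0 ms] := L0_pos_inv m0; exists (e * s).
have es0 : L0_pos (e * s) by exact: L0_posM.
have es1 p : Q p -> p ((e * s) *: y) <= e.
  move=> Qp; have [_ pZ _] := L0_seminormsP p (QE _ Qp); rewrite pZ.
  apply/L0_leP; move/L0_leP: (mP _ Qp) => h; move/L0_eqP: ms => ms.
  apply: filter_app h; apply: filter_app e0; apply: filter_app s0.
  apply: filter_app ms; L0_eval => ms s0 e0 h.
  rewrite ger0_norm; last by rewrite mulr_ge0// ltW.
  by rewrite -mulrA ler_piMr ?(ltW e0)// -ms [s w * _]mulrC ler_wpM2r// ltW.
split=> //; apply/L0_ballP => p Qp; first exact: es1.
by rewrite L0_seminormN; [exact: es1|exact/L0_seminormsP/QE].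
Qed.

(** The same [Q] and [e] serve at every point. Intended for the maps sending y to x + y and to x -
    y. *)
Lemma Tc_nonexpansive_continuous (h : E -> E) :
  (forall p y z, L0_seminorms E p -> p (h y - h z) <= p (y - z)) ->
  continuous (h : Tc E -> Tc E).
Proof.
move=> hP y A [Q [e [fQ QE e0 QA]]]; exists Q, e; split=> // z /L0_ballP zy.
apply: QA; apply/L0_ballP => p Qp; apply: le_trans (zy p Qp).
exact/hP/QE.
Qed.

Lemma L0_linearZ (u : {linear E -> (L0 P)^o}) (a : L0 P) y :
  u (a *: y) = a * (u y : L0 P) :> L0 P.
Proof. by rewrite linearZ. Qed.

(** By homogeneity: a displacement in the ball of radius e * e' lies, once divided by e', in the
    ball of radius e, so its image is at most e' in absolute value. *)
Lemma conjugate_space_bounded (u : {linear E -> (L0 P)^o}) Q e :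
  finite_set Q -> Q `<=` L0_seminorms E -> L0_pos e ->
  (forall y, L0_ball Q e y -> L0_abs (u y) <= 1) -> conjugate_space u.
Proof.
move=> fQ QE e0 uQ y A [Q' [e' [fQ' Q'E e'0 Q'A]]].
have [s s0 e's] := L0_pos_inv e'0.
exists Q, (e * e'); split => //; first exact: L0_posM.
(* The only seminorm on the regular module is [L0_abs]. *)
move=> z /L0_ballP zy; apply: Q'A; apply/L0_ballP => q /Q'E ->.
have : L0_abs (u (s *: (z - y))) <= 1.
  apply: uQ; apply/L0_ballP => p Qp.
  have [_ pZ _] := L0_seminormsP p (QE _ Qp); rewrite pZ.
  move/L0_leP: (zy p Qp) => h; move/L0_eqP: e's => e's; apply/L0_leP.
  apply: filter_app h; apply: filter_app s0; apply: filter_app e's.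
  L0_eval => e's s0 h; rewrite gtr0_norm// (le_trans (ler_wpM2l (ltW s0) h))//.
  by rewrite mulrCA [s w * _]mulrC e's mulr1.
rewrite L0_linearZ linearB/=; set v := u z - u y.
move=> /L0_leP h; apply/L0_leP; move/L0_eqP: e's => e's.
apply: filter_app h; apply: filter_app e'0; apply: filter_app s0.
apply: filter_app e's; L0_eval => e's s0 e'0.
rewrite normrM gtr0_norm// => h.
by have := ler_wpM2l (ltW e'0) h; rewrite mulrA e's mul1r mulr1.
Qed.

End seminorms.

(** * Convexity with real-valued bounds, and locality *)

Section convex_functions.
Context d (T : measurableType d) (R : realType) (P : probability T R).
Variable E : rlcModType P.
Variable f : E -> eL0 P.
Hypothesis f_convex : L0_convex_fun f.

(** Bounds taken in [L0 P] keep the later convexity estimates in ring arithmetic, away from infinite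
    values. *)
Lemma L0_convex_fun_le a b (r s xi : L0 P) : 0 <= xi -> xi <= 1 ->
  f a <= eL0_of r -> f b <= eL0_of s ->
  f (xi *: a + (1 - xi) *: b) <= eL0_of (xi * r + (1 - xi) * s).
Proof.
move=> xi0 xi1 far fbs; apply: le_trans (f_convex a b xi0 xi1) _.
apply/eL0_leP; move/eL0_leP: far => far; move/eL0_leP: fbs => fbs.
move/L0_leP: xi0 => xi0; move/L0_leP: xi1 => xi1.
apply: filter_app far; apply: filter_app fbs; apply: filter_app xi0.
apply: filter_app xi1; L0_eval => xi1 xi0 fbs far.
rewrite [leRHS]dEFinD; apply: lee_dD.
  by rewrite EFinM lee_wpmul2l// lee_fin.
by rewrite EFinM lee_wpmul2l// lee_fin subr_ge0.
Qed.

(** Convexity with the indicator of [A] as weight: the combination of z and y is then y itself, and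
    on [A] the bound reduces to f z because 0 times an infinite value is 0. *)
Lemma L0_convex_fun_local (A : set T) (mA : measurable A) y z :
  L0_indic P mA *: y = L0_indic P mA *: z ->
  \forall w \ae P, A w -> (f y w <= f z w)%E.
Proof.
move=> yz; have [I0 I1] := L0_indic_bounds P mA.
have := f_convex z y I0 I1; rewrite -yz -scalerDl addrC subrK scale1r.
move=> /eL0_leP h; apply: filter_app h; apply: filter_app (L0_indicE P mA).
L0_eval => + Aw; rewrite indicE mem_set// subrr mul1e mul0e.
by rewrite dadde0.
Qed.

(** * The cone of directional bounds at [x] *)

Variable x : E.
Variable r0 : L0 P.
Hypothesis r0E : eL0_of r0 = f x.

Definition descent_cone : set (E * L0 P) :=
  [set p | exists2 t, L0_pos t & f (x + t *: p.1) <= eL0_of (r0 + t * p.2)].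

Lemma descent_cone_cone : L0_cone descent_cone.
Proof.
split.
- by exists 1; [exact: L0_pos1|rewrite /= scaler0 mulr0 !addr0 r0E].
- move=> y c y' c' [t t0 /= tP] [t' t'0 /= t'P].
  have [s s0 ts] := L0_pos_inv (L0_posD t0 t'0).
  (* With step t t' / (t + t') the new point combines x + t y and x + t' y' with weights t' / (t +
     t') and t / (t + t'). *)
  exists (t * t' * s); first by apply: L0_posM => //; exact: L0_posM.
  have t's0 : 0 <= t' * s by apply/L0_pos_ge0/L0_posM.
  have tsE : 1 - t' * s = t * s by rewrite -ts mulrDl addrK.
  have t's1 : t' * s <= 1 by rewrite -L0_subr_ge0 tsE; apply/L0_pos_ge0/L0_posM.
  have := L0_convex_fun_le t's0 t's1 tP t'P; rewrite /= tsE.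
  congr (f _ <= eL0_of _).
  - rewrite !scalerDr !scalerA addrACA -scalerDl -mulrDl [t' + t]addrC ts scale1r.
    by congr (_ + (_ *: _ + _ *: _)); ring.
  - have -> : t' * s * (r0 + t * c) + t * s * (r0 + t' * c') =
      (t + t') * s * r0 + t * t' * s * (c + c') by ring.
    by rewrite ts mul1r.
- move=> s y c s0 [t t0 /= tP]; have [s' s'0 ss'] := L0_pos_inv s0.
  exists (t * s') => /=; first exact: L0_posM.
  by rewrite scalerA mulrA -[t * s' * s]mulrA [s' * s]mulrC ss' mulr1.
Qed.

Lemma descent_cone_salient : L0_salient descent_cone.
Proof.
move=> c [t t0]; rewrite /= scaler0 addr0 -r0E => /eL0_of_le.
by rewrite -L0_subr_ge0 [r0 + _]addrC addrK; exact: L0_pmulr_ge0.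
Qed.

Hypothesis f_proper : is_proper f.

Lemma dom_real y : dom f y -> exists a, eL0_of a = f y.
Proof. by apply: eL0_real; exact: f_proper.2. Qed.

(** A short enough step from the interior point along y stays in the domain, and the difference
    quotient there serves as c. *)
Lemma descent_cone_full y : interior (dom f : set (Tc E)) x ->
  exists c, descent_cone (y, c).
Proof.
move=> [Q [e [fQ QE e0 QA]]]; have [t [t0 ty _]] := L0_ball_absorbs y fQ QE e0.
have [|a aE] := @dom_real (x + t *: y).
  by apply: QA; rewrite addrAC subrr add0r.
have [s s0 ts] := L0_pos_inv t0; exists (s * (a - r0)); exists t => //=.
by rewrite -aE mulrA ts mul1r addrCA subrr addr0.
Qed.

Lemma descent_cone_subgradient (u : {linear E -> (L0 P)^o}) :
  (forall y c, descent_cone (y, c) -> (u y : L0 P) <= c) ->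
  forall y, eL0_of (u (y - x)) <= eL0_add (f y) (eL0_opp (f x)).
Proof.
(* [f y] may be +oo on a non-null event: the cone is tested at the truncation
   [I *: (y - x)], where I is the indicator of the event [f y < +oo]. *)
move=> uP y; pose A := [set w | (f y w < +oo)%E].
have mA : measurable A.
  rewrite -[A]setTI; exact: emeasurable_fun_infty_o.
have [I0 I1] := L0_indic_bounds P mA.
(* [s] bounds f at the truncated point: it is f y on [A], and r0 = f x off [A], where the truncation
   leaves x. *)
have [|s sE] := @L0_mk_exists _ _ _ P
    (fun w => if (f y w < +oo)%E then fine (f y w) else r0 w).
  apply: measurable_fun_ifT.
  - by apply: measurable_fun_lte => //; exact: eL0_measurable.
  - by apply: measurableT_comp => //; exact: eL0_measurable.
  - exact: L0_measurable.
have fyN := f_proper.2 y.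
set I := L0_indic P mA in I0 I1.
have /uP : descent_cone (I *: (y - x), s - r0).
  exists 1; first exact: L0_pos1.
  rewrite /= scale1r mul1r [r0 + _]addrC subrK.
  have -> : x + I *: (y - x) = I *: y + (1 - I) *: x.
    by rewrite scalerBr scalerBl scale1r addrCA.
  apply: le_trans (f_convex _ _ I0 I1) _; rewrite -r0E.
  apply/eL0_leP; apply: filter_app sE; apply: filter_app (L0_indicE P mA).
  apply: filter_app fyN; rewrite -/I; L0_eval => fyN IE sE.
  rewrite IE sE indicE; case: ifPn => [fy|fy].
    by rewrite mem_set// subrr mul1e mul0e dadde0 fineK// fin_numE gt_eqF// lt_eqF.
  by rewrite memNset; [rewrite subr0 mul1e mul0e dadd0e|exact/negP].
rewrite L0_linearZ => /L0_leP h.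
apply/eL0_leP; apply: filter_app h; apply: filter_app sE.
apply: filter_app (L0_indicE P mA); apply: filter_app fyN; rewrite -/I -r0E.
L0_eval => fyN IE sE; rewrite IE sE indicE; case: ifPn => [fy|].
  rewrite mem_set// mul1r; move: fy fyN; case: (f y w) => [b| |]//=.
by rewrite -leNgt leye_eq => /eqP ->; rewrite daddye ?leey.
Qed.

(** Take m = 1 / t + |c|: then s / t is a convex weight between x + t y and x, and the resulting
    bound r0 + s c is at most r0 + 1. *)
Lemma descent_cone_bound y c : descent_cone (y, c) ->
  exists2 m, L0_pos m & forall s, L0_pos s -> s * m <= 1 ->
    f (x + s *: y) <= eL0_of (r0 + 1).
Proof.
move=> [t t0 /= tP]; have [t' t'0 tt'] := L0_pos_inv t0.
have absc0 : 0 <= L0_abs c by apply/L0_leP; L0_eval.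
exists (t' + L0_abs c).
  move/L0_leP: absc0 => absc0; rewrite /L0_pos /=.
  apply: filter_app t'0; apply: filter_app absc0; L0_eval => c0 t'0.
  exact: ltr_wpDr.
move=> s s0; rewrite mulrDr => sm.
have st'0 : 0 <= s * t' by apply/L0_pos_ge0/L0_posM.
have sc0 : 0 <= s * L0_abs c by apply: L0_mulr_ge0 => //; exact: L0_pos_ge0.
have st'1 : s * t' <= 1.
  by apply: le_trans sm; rewrite -L0_subr_ge0 addrAC subrr add0r.
have fx : f x <= eL0_of r0 by rewrite r0E.
apply: le_trans (_ : eL0_of (r0 + s * c) <= _).
  have := L0_convex_fun_le st'0 st'1 tP fx; congr (f _ <= eL0_of _).
    rewrite scalerDr scalerA -mulrA [t' * t]mulrC tt' mulr1 addrAC -scalerDl.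
    by rewrite [s * t' + _]addrC subrK scale1r.
  have -> : s * t' * (r0 + t * c) + (1 - s * t') * r0 = r0 + s * (t * t') * c by ring.
  by rewrite tt' mulr1.
apply/eL0_of_le; move/L0_leP: sm => sm; move/L0_leP: st'0 => st'0; apply/L0_leP.
apply: filter_app sm; apply: filter_app st'0; apply: filter_app s0; L0_eval.
move=> s0 st'0 sm; rewrite lerD2l (le_trans _ sm)//.
by rewrite ler_wpDl// ler_wpM2l ?ler_norm// ltW.
Qed.

(** Imposing both signs makes the set balanced and later bounds the functional on both sides. *)
Definition symmetric_sublevel : set E :=
  [set y | f (x + y) <= eL0_of (r0 + 1) /\ f (x - y) <= eL0_of (r0 + 1)].

Lemma symmetric_sublevel_balanced : L0_balanced symmetric_sublevel.
Proof.
(* [x + eta *: y] is the combination of [x + y] and [x - y] with weights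
   (1 + eta) / 2 and (1 - eta) / 2. *)
have scale_le (eta : L0 P) y : L0_abs eta <= 1 -> f (x + y) <= eL0_of (r0 + 1) ->
    f (x - y) <= eL0_of (r0 + 1) -> f (x + eta *: y) <= eL0_of (r0 + 1).
  move=> /L0_abs_le[etaN eta1] fDy fBy.
  have [h h0 hh] := L0_pos_inv (L0_posD (@L0_pos1 _ _ _ P) (@L0_pos1 _ _ _ P)).
  have hE (a : L0 P) : h * a + h * a = a.
    by rewrite -[RHS]mul1r -hh; ring.
  have k0 : 0 <= h * (1 + eta).
    apply: L0_mulr_ge0; first exact: L0_pos_ge0.
    by rewrite addrC -[1]opprK L0_subr_ge0.
  have kE : 1 - h * (1 + eta) = h * (1 - eta).
    by rewrite -{1}hh; ring.
  have k1 : h * (1 + eta) <= 1.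
    rewrite -L0_subr_ge0 kE; apply: L0_mulr_ge0; first exact: L0_pos_ge0.
    by rewrite L0_subr_ge0.
  have := L0_convex_fun_le k0 k1 fDy fBy; rewrite kE.
  congr (f _ <= eL0_of _).
  + rewrite scalerDr [_ *: (x - y)]scalerDr scalerN addrACA -scalerDl -scalerBl.
    congr (_ + _).
      rewrite (_ : _ + _ = 1) ?scale1r//.
      by rewrite -[RHS]hh; ring.
    by congr (_ *: _); rewrite -[RHS]hE; ring.
  + by rewrite -[RHS]hE; ring.
move=> eta y eta1 [fDy fBy]; split; first exact: scale_le.
have := scale_le eta (- y) eta1; rewrite scalerN opprK; exact.
Qed.

Lemma symmetric_sublevel_neighborhood :
  L0_prebarreled E -> countable_concatenation [set: E] -> Tc_lsc f ->
  interior (dom f : set (Tc E)) x ->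
  nbhs (0 : Tc E) symmetric_sublevel.
Proof.
move=> E_prebarreled E_concat f_lsc x_int.
apply: E_prebarreled; first split.
- pose C := [set y | f y <= eL0_of (r0 + 1)].
  have Ccl : closed (C : set (Tc E)) by exact: f_lsc.
  apply: (@closedI (Tc E) ((fun y => x + y) @^-1` C) ((fun y => x - y) @^-1` C)).
  + have /continuous_closedP : continuous ((fun y => x + y) : Tc E -> Tc E).
      apply: Tc_nonexpansive_continuous => p y z _.
      by rewrite opprD addrACA subrr add0r.
    by apply.
  + have /continuous_closedP : continuous ((fun y => x - y) : Tc E -> Tc E).
      apply: Tc_nonexpansive_continuous => p y z pE.
      rewrite opprD addrACA subrr add0r -opprD L0_seminormN//.
      exact: L0_seminormsP.
    by apply.
- exact: symmetric_sublevel_balanced.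
- move=> y y' xi [fDy fBy] [fDy' fBy'] xi0 xi1; split.
  + have := L0_convex_fun_le xi0 xi1 fDy fDy'.
    congr (f _ <= eL0_of _); first by
      rewrite !scalerDr addrACA -scalerDl [xi + _]addrC subrK scale1r.
    by ring.
  + have := L0_convex_fun_le xi0 xi1 fBy fBy'.
    congr (f _ <= eL0_of _); first by
      rewrite !scalerDr !scalerN opprD addrACA -scalerDl [xi + _]addrC subrK scale1r.
    by ring.
- move=> y; have [c Kc] := descent_cone_full y x_int.
  have [c' Kc'] := descent_cone_full (- y) x_int.
  have [m m0 mP] := descent_cone_bound Kc.
  have [m' m'0 m'P] := descent_cone_bound Kc'.
  (* The scalar 1 / (m + m') meets the bounds for both y and - y. *)
  have mm'0 := L0_posD m0 m'0; have [s s0 ms] := L0_pos_inv mm'0.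
  have Bsy : symmetric_sublevel (s *: y).
    split; [apply: mP => //|rewrite -scalerN; apply: m'P => //].
      rewrite -ms -L0_subr_ge0 [_ * s]mulrC -mulrBr [m + _]addrC addrK.
      exact/L0_pos_ge0/L0_posM.
    by rewrite -ms -L0_subr_ge0 [_ * s]mulrC -mulrBr addrK; exact/L0_pos_ge0/L0_posM.
  exists s => // eta etas.
  (* If |eta| <= s, then eta is s times a factor of modulus at most 1, so balancedness applies. *)
  have -> : eta *: y = (eta * (m + m')) *: (s *: y).
    by rewrite scalerA -mulrA ms mulr1.
  apply: symmetric_sublevel_balanced => //.
  move/L0_leP: etas => etas; move/L0_eqP: ms => ms.
  apply/L0_leP; apply: filter_app etas; apply: filter_app mm'0.
  apply: filter_app ms; L0_eval => ms mm'0 etas.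
  by rewrite normrM (gtr0_norm mm'0) -ms mulrC ler_wpM2l// ltW.
- move=> y_ A_ mA yB Atriv Acov.
  have [y _ yE] := E_concat y_ A_ mA (fun _ => I) Atriv Acov.
  (* On each piece f (h y) is at most f (h y_n) by locality, and the pieces cover the space; this
     serves both signs. *)
  have shift (h : E -> E) :
      (forall n, L0_indic P (mA n) *: h y = L0_indic P (mA n) *: h (y_ n)) ->
      (forall n, f (h (y_ n)) <= eL0_of (r0 + 1)) -> f (h y) <= eL0_of (r0 + 1).
    move=> hE hle; apply/eL0_leP.
    have : \forall w \ae P, forall n, A_ n w -> (f (h y) w <= eL0_of (r0 + 1)%R w)%E.
      apply: ae_foralln => n; have /eL0_leP le_n := hle n.
      apply: filterS2 (L0_convex_fun_local (hE n)) le_n => w yn ynr Aw.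
      exact: le_trans (yn Aw) ynr.
    apply: filterS => w Hw; have : [set: T] w by [].
    by rewrite -Acov => -[n _ /Hw].
  exists y => //; split.
  + apply: (shift (fun y => x + y)) => n; last exact: (yB n).1.
    by rewrite !scalerDr yE.
  + apply: (shift (fun y => x - y)) => n; last exact: (yB n).2.
    by rewrite !scalerBr yE.
Qed.

End convex_functions.

Theorem corollary4p12 (d : measure_display) (T : measurableType d)
    (R : realType) (P : probability T R) (E : rlcModType P)
    (E_prebarreled : L0_prebarreled E)
    (E_concat : countable_concatenation [set: E])
    (f : E -> eL0 P) (f_proper : is_proper f) (f_lsc : Tc_lsc f)
    (f_convex : L0_convex_fun f) (x : E)
    (x_int : interior (dom f : set (Tc E)) x) :
  subdifferential f x !=set0.
Proof.
have [|r0 r0E] := @dom_real _ _ _ _ _ f f_proper x.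
  exact: interior_subset x_int.
have [u uP] := L0_cone_separation (descent_cone_cone f_convex r0E)
  (descent_cone_salient r0E)
  (fun y => descent_cone_full r0 f_proper y x_int).
exists u; split; last exact: (descent_cone_subgradient f_convex r0E f_proper).
have [Q [e [fQ QE e0 QB]]] := symmetric_sublevel_neighborhood f_convex r0E
  f_proper E_prebarreled E_concat f_lsc x_int.
apply: (conjugate_space_bounded fQ QE e0) => y Qy.
have [|fDy fBy] := QB y; first by rewrite subr0.
(* The bound says that (z, 1) is in the descent cone, with step 1. *)
have u1 z : f (x + z) <= eL0_of (r0 + 1) -> (u z : L0 P) <= 1.
  by move=> fz; apply: uP; exists 1; [exact: L0_pos1|rewrite /= scale1r mulr1].
apply/L0_abs_le; split; last exact: u1.
by rewrite L0_lerNl -[- _](linearN u); exact: u1.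
Qed.
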